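(* Let $k$ be a field of characteristic $0$. If $A_1,\dots,A_g\in M_d(k)$ generate $M_d(k)$ as a $k$-algebra, then there exist $n\in\mathbb N$ and $X_1,\dots,X_g\in M_n(k)$ such that $\sum_{i=1}^gX_i\otimes A_i$ has a nonzero eigenvalue with geometric multiplicity $1$. If $k=\mathbb C$ and $A_1,\dots,A_g$ are hermitian, then $X_1,\dots,X_g$ can also be chosen hermitian.
   Context: $\otimes$ is the Kronecker product of matrices. ''Generate as a $k$-algebra'' is meant in the sense of possibly non-unital algebras: $M_d(k)$ is the linear span of all nonempty products of the $A_i$. The eigenvalue lies in $k$, and its geometric multiplicity is the dimension of the corresponding eigenspace. *)

(* Defs.v *)
From HB Require Import structures.
From mathcomp Require Export all_boot all_order all_algebra.
From mathcomp Require Export reals.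
From mathcomp Require Export complex mxtens.
Set Implicit Arguments.
Unset Strict Implicit.
Unset Printing Implicit Defensive.
Import GRing.Theory Num.Theory.
Local Open Scope ring_scope.

(* Non-unital generation: the empty word, whose product is the identity
   matrix, is excluded. *)
Definition generates_mx (k : fieldType) (d g : nat) (A : 'I_g -> 'M[k]_d) : Prop :=
  forall M : 'M[k]_d, exists2 s : seq (k * seq 'I_g),
    forall p, p \in s -> p.2 != [::] &
    M = \sum_(p <- s) p.1 *: \big[mulmx/1%:M]_(i <- p.2) A i.

(* [eigenspace M a] is the space of row vectors v with v *m M = a *: v.  Its
   dimension is m - \rank (M - a%:M), which is also the dimension of the space
   of column vectors u with M *m u = a *: u. *)
Definition has_simple_nonzero_eigenvalue (k : fieldType) (m : nat) (M : 'M[k]_m) : Prop :=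
  exists a : k, [/\ a != 0, eigenvalue M a & \rank (eigenspace M a) = 1%N].

(* Main.v *)
(** Some noncommutative polynomial without constant term takes the value [E_00]
    at [A].  Linearizing it, with one block per word, gives [X] such that the
    1-eigenvectors of [sum X_i (x) A_i] correspond to the row vectors fixed by
    [E_00], which form a line.

    Over the complex numbers write [X = H + 'i K] with [H] and [K] hermitian, and
    replace ['i] by a variable [z].  If no integer value of [z] gave a simple
    nonzero eigenvalue, then for those [z] every eigenvalue would be [0] or make
    all corank one minors of [t - sum (H_i + z K_i) (x) A_i] vanish at it.  For a
    fixed minor this says that the characteristic polynomial divides a power of
    [t] times the minor, a condition which is polynomial in [z] and so extends
    from the integers to [z = 'i], where it fails for a suitable minor. *)
Require Import Defs.
Set Implicit Arguments.
Unset Strict Implicit.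
Unset Printing Implicit Defensive.
Import GRing.Theory Num.Theory.
Local Open Scope ring_scope.

(** * Row vectors over a tensor product, cut into blocks *)

Section TensorBlocks.
Variables (k : fieldType) (n d : nat).

Definition tblock (v : 'rV[k]_(n * d)) (p : 'I_n) : 'rV[k]_d :=
  \row_j v 0 (mxtens_index (p, j)).

Lemma tblockP (v w : 'rV[k]_(n * d)) : tblock v =1 tblock w -> v = w.
Proof.
move=> eq_vw; apply/rowP=> j; case: (mxtens_indexP j) => p q.
by have /rowP/(_ q) := eq_vw p; rewrite !mxE.
Qed.

Lemma tblockZ a (v : 'rV[k]_(n * d)) p : tblock (a *: v) p = a *: tblock v p.
Proof. by apply/rowP=> j; rewrite !mxE. Qed.

(** The pencil acts like a weighted graph: the edge from [p] to [q] labelled [i] multiplies the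
    block at [p] by [A i], with weight [X i p q]. *)
Lemma tblock_sum_tens (I : finType) (X : I -> 'M[k]_n) (A : I -> 'M[k]_d)
    (v : 'rV[k]_(n * d)) q :
  tblock (v *m (\sum_i X i *t A i)) q =
  \sum_i \sum_p X i p q *: (tblock v p *m A i).
Proof.
rewrite mulmx_sumr; apply/rowP=> j; rewrite mxE summxE summxE.
apply: eq_bigr => i _; rewrite mxE summxE.
transitivity (\sum_(pj : 'I_n * 'I_d)
    v 0 (mxtens_index (pj.1, pj.2)) * (X i pj.1 q * A i pj.2 j)).
  rewrite (reindex (@mxtens_index n d)) /=.
    by apply: eq_bigr => -[p l] _; rewrite tensmxE.
  by exists (@mxtens_unindex n d) => x _; rewrite (mxtens_indexK, mxtens_unindexK).
rewrite -(pair_bigA _ (fun p l => v 0 (mxtens_index (p, l)) * (X i p q * A i l j))) /=.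
apply: eq_bigr => p _; rewrite !mxE mulr_sumr; apply: eq_bigr => l _.
by rewrite !mxE mulrCA.
Qed.

End TensorBlocks.

(** * Linearization of a noncommutative polynomial *)

Section WordPencil.
Variables (k : fieldType) (d g : nat) (A : 'I_g -> 'M[k]_d).

Definition word_mx (w : seq 'I_g) : 'M[k]_d := \big[mulmx/1%:M]_(i <- w) A i.

Lemma word_mx_rcons w i : word_mx (rcons w i) = word_mx w *m A i.
Proof.
rewrite /word_mx; elim: w => [|j w IHw]; first by rewrite /= big_cons !big_nil mul1mx mulmx1.
by rewrite rcons_cons !big_cons IHw mulmxA.
Qed.

Variables (L : nat) (s : seq (k * seq 'I_g)).
Hypothesis s_neq0 : forall x, x \in s -> x.2 != [::].
Hypothesis s_size : forall x, x \in s -> (size x.2 <= L)%N.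

Local Notation W := (L.-bseq 'I_g).
Local Notation n := #|{: W}|.
Local Notation p := (\sum_(x <- s) x.1 *: word_mx x.2).

(* Weighted adjacency matrices of the tree of words of length at most [L], with
   extra edges back to the root [::], where the edge from [u] labelled [i]
   carries the coefficient of [rcons u i] in [p]. *)
Definition word_pencil (i : 'I_g) : 'M[k]_n :=
  \matrix_(a, b)
    let u := enum_val a : W in let w := enum_val b : W in
    if w == [::] :> seq 'I_g then \sum_(x <- s | x.2 == rcons u i) x.1
    else (w == rcons u i :> seq 'I_g)%:R.

Local Notation Lam := (\sum_i word_pencil i *t A i).
Local Notation blk v w := (tblock v (enum_rank (w : W))).

(** A nonempty word splits in only one way into a prefix and a last letter, so a single term of the
    double sum survives. *)
Lemma sum_words (V : nmodType) (F : seq 'I_g -> 'I_g -> V) (u : seq 'I_g) :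
  u != [::] -> (size u <= L)%N ->
  exists u0 i0, u = rcons u0 i0 /\
  \sum_i \sum_(w : W) (if u == rcons w i then F w i else 0) = F u0 i0.
Proof.
case/lastP: u => [//|u0 i0] _; rewrite size_rcons => szu.
exists u0, i0; split=> //; rewrite (bigD1 i0) //= [X in _ + X]big1 => [|i ne_i].
  rewrite addr0 (bigD1 (Bseq (ltnW szu))) //= eqxx [X in _ + X]big1 ?addr0 // => w ne_w.
  rewrite eqseq_rcons eqxx andbT eq_sym; case: eqP => // eq_w.
  by case/eqP: ne_w; apply: val_inj.
by rewrite big1 // => w _; rewrite eqseq_rcons [i0 == i]eq_sym (negPf ne_i) andbF.
Qed.

Lemma word_pencil_block_root v :
  tblock (v *m Lam) (enum_rank ([bseq] : W)) =
  \sum_(x <- s) x.1 *: (\sum_i \sum_(w : W)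
     if x.2 == rcons w i then blk v w *m A i else 0).
Proof.
rewrite tblock_sum_tens.
under [RHS]eq_bigr do rewrite scaler_sumr.
rewrite [RHS]exchange_big; apply: eq_bigr => i _.
under [RHS]eq_bigr do rewrite scaler_sumr.
rewrite [RHS]exchange_big [LHS](reindex (@enum_rank W)) /=; last exact: onW_bij _ (@enum_rank_bij _).
apply: eq_bigr => w _; rewrite mxE !enum_rankK /= big_mkcond scaler_suml.
by apply: eq_bigr => x _; case: eqP; rewrite ?scaler0 ?scale0r.
Qed.

Lemma word_pencil_block_rcons v (w : W) : w != [::] :> seq 'I_g ->
  tblock (v *m Lam) (enum_rank w) =
  \sum_i \sum_(u : W) if w == rcons u i :> seq 'I_g then blk v u *m A i else 0.
Proof.
move=> w_neq0; rewrite tblock_sum_tens; apply: eq_bigr => i _.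
rewrite (reindex (@enum_rank W)) /=; last exact: onW_bij _ (@enum_rank_bij _).
apply: eq_bigr => u _; rewrite mxE !enum_rankK /= (negPf w_neq0).
by case: eqP; rewrite ?scale1r ?scale0r.
Qed.

(** Reading the tree edges from the root outwards, the root block determines all others; the edges
    back to the root then impose the one remaining equation. *)
Lemma word_pencil_fixedP v :
  v *m Lam = v <->
  (forall w : W, blk v w = blk v [bseq] *m word_mx w) /\
  blk v [bseq] *m p = blk v [bseq].
Proof.
(* An edge back to the root supplies the last letter of a word of [s] together with its coefficient,
   so the contributions add up to [p]. *)
have eval_root : (forall w : W, blk v w = blk v [bseq] *m word_mx w) ->
  tblock (v *m Lam) (enum_rank ([bseq] : W)) = blk v [bseq] *m p.
  move=> vE; rewrite word_pencil_block_root mulmx_sumr big_seq [RHS]big_seq.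
  apply: eq_bigr => x x_s; rewrite -scalemxAr; congr (_ *: _).
  under eq_bigr => i _ do under eq_bigr => w _ do rewrite vE.
  have [u [i [-> ->]]] := sum_words (fun w i => blk v [bseq] *m word_mx w *m A i)
    (s_neq0 x_s) (s_size x_s).
  by rewrite word_mx_rcons mulmxA.
split=> [fix_v | [vE fix_p]].
  have vE (w : W) : blk v w = blk v [bseq] *m word_mx w.
    case: w => w; elim/last_ind: w => [|w i IHw] szw.
      rewrite /word_mx big_nil mulmx1; congr (tblock v (enum_rank _)).
      exact: val_inj.
    have szw' : (size w <= L)%N by rewrite (leq_trans _ szw) // size_rcons.
    rewrite -{1}fix_v word_pencil_block_rcons /=; last by case: (w).
    (* [sum_words] needs a function of all words; the default value on words longer than [L] is
       never met. *)
    pose F (u : seq 'I_g) i := tblock v (enum_rank (insub_bseq L u)) *m A i.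
    transitivity (F w i); last first.
      rewrite /F word_mx_rcons mulmxA -(IHw szw'); congr (tblock v (enum_rank _) *m _).
      by apply: val_inj; rewrite insubdK.
    have [||u [j [/rcons_inj[-> ->]]]] // := @sum_words _ F (rcons w i).
      by case: (w).
    move=> <-; apply: eq_bigr => j' _; apply: eq_bigr => u' _.
    case: ifP => // _; congr (tblock v (enum_rank _) *m _).
    by apply: val_inj; rewrite insubdK //; apply: size_bseq.
  by split=> //; rewrite -eval_root ?fix_v.
apply: tblockP => q; rewrite -[q]enum_valK; move: (enum_val q) => w.
have [w0|w_neq0] := eqVneq (w : seq 'I_g) [::].
  have -> : w = [bseq] by apply: val_inj.
  by rewrite eval_root.
rewrite word_pencil_block_rcons // [RHS]vE.
under eq_bigr => i _ do under eq_bigr => u _ do rewrite vE.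
have [u [i [-> ->]]] := sum_words (fun w i => blk v [bseq] *m word_mx w *m A i)
    w_neq0 (size_bseq w).
by rewrite word_mx_rcons mulmxA.
Qed.

End WordPencil.

(** * A simple nonzero eigenvalue over any field *)

Lemma simple_eigenvalue_of_eigenvector (k : fieldType) m (M : 'M[k]_m) (a : k) (u : 'rV_m) :
  a != 0 -> u != 0 -> u *m M = a *: u ->
  (forall v : 'rV_m, v *m M = a *: v -> (v <= u)%MS) ->
  has_simple_nonzero_eigenvalue M.
Proof.
move=> a_neq0 u_neq0 uM vM; exists a; split=> //; first by apply/eigenvalueP; exists u.
have <- : \rank u = 1%N by rewrite rank_rV u_neq0.
apply: eqmx_rank; apply/andP; split; last exact/eigenspaceP.
by apply/rV_subP => v /eigenspaceP/vM.
Qed.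

Lemma exists_simple_eigenvalue (k : fieldType) (d g : nat) (A : 'I_g -> 'M[k]_d) :
  (0 < d)%N -> generates_mx A ->
  exists (n : nat) (X : 'I_g -> 'M[k]_n),
    has_simple_nonzero_eigenvalue (\sum_(i < g) X i *t A i).
Proof.
case: d A => // d A _ genA.
have [s s_neq0 sE] := genA (delta_mx 0 0).
pose L := \max_(x <- s) size x.2.
have s_size x : x \in s -> (size x.2 <= L)%N.
  by move=> x_s; apply: (leq_bigmax_seq (F := fun x : k * seq 'I_g => size x.2)).
exists #|{: L.-bseq 'I_g}|, (word_pencil L s).
have fixP := word_pencil_fixedP A s_neq0 s_size; rewrite /word_mx -sE -/(word_mx _) in fixP.
pose W := L.-bseq 'I_g.
pose e : 'rV[k]_d.+1 := delta_mx 0 0.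
(* The fixed vector with root block [e]; the other blocks are forced by [word_pencil_fixedP]. *)
pose u : 'rV[k]_(#|{: W}| * d.+1) := \row_j
  (e *m word_mx A (enum_val (mxtens_unindex j).1 : W)) 0 (mxtens_unindex j).2.
have uE (w : W) : tblock u (enum_rank w) = e *m word_mx A w.
  by apply/rowP=> j; rewrite /tblock mxE mxE mxtens_indexK /= enum_rankK.
have u0 : tblock u (enum_rank ([bseq] : W)) = e.
  by rewrite uE /word_mx big_nil mulmx1.
apply: (@simple_eigenvalue_of_eigenvector _ _ _ 1 u (oner_neq0 k)).
- apply: contraTneq (oner_neq0 k) => u_eq0.
  have /rowP/(_ 0) := u0; rewrite u_eq0 /e !mxE !eqxx /= => /esym/eqP.
  by rewrite negbK.
- rewrite scale1r; apply/fixP; split; first by move=> w; rewrite uE u0.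
  by rewrite u0 mul_delta_mx.
move=> v; rewrite scale1r => /fixP[vE v0].
have {}v0 : tblock v (enum_rank ([bseq] : W)) =
    tblock v (enum_rank ([bseq] : W)) 0 0 *: e.
  rewrite -{1}v0; apply/rowP=> j; rewrite !mxE (bigD1 0) //= big1 => [|i i0].
    by rewrite !mxE addr0.
  by rewrite !mxE (negPf i0) mulr0.
apply/sub_rVP; exists (tblock v (enum_rank ([bseq] : W)) 0 0).
apply: tblockP => q; rewrite tblockZ -[q]enum_valK; move: (enum_val q) => w.
by rewrite vE uE [in LHS]v0 -scalemxAl.
Qed.

(** * Divisibility of polynomials depending on a parameter *)

Lemma dvdp_expn_of_roots (C : closedFieldType) (p q : {poly C}) (n : nat) :
  p \is monic -> (size p).-1 = n -> (forall z, root p z -> root q z) ->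
  p %| q ^+ n.
Proof.
have [rs ->] := closed_field_poly_normal p => /monicP.
rewrite lead_coefZ (monicP (monic_prod_XsubC _ _ _)) mulr1 => ->.
rewrite scale1r size_prod_XsubC /= => <- {n} roots_q.
have {}roots_q : all (root q) rs.
  by apply/allP => z z_rs; apply: roots_q; rewrite root_prod_XsubC.
elim: rs roots_q => [|z rs IHrs] /=; first by rewrite big_nil dvd1p.
case/andP=> qz /IHrs; rewrite big_cons exprS; apply: dvdp_mul.
by rewrite dvdp_XsubCl.
Qed.

Section Specialization.
Variable k : fieldType.
Implicit Types p q : {poly {poly k}}.

Local Notation spec z p := (map_poly (horner_eval (z : k)) p).

(* The remainder of [q] modulo [p] has coefficients in [k[z]]; they vanish at
   infinitely many [z], hence identically. *)
Lemma dvdp_spec p q (S : nat -> k) : p \is monic -> injective S ->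
  (forall i, spec (S i) p %| spec (S i) q) -> forall z, spec z p %| spec z q.
Proof.
move=> p_monic S_inj dvdS.
have qE := Pdiv.RingMonic.rdivp_eq p_monic q.
set r := Pdiv.Ring.rmodp q p in qE; suff r0 : r = 0.
  by move=> z; rewrite qE r0 addr0 rmorphM /= dvdp_mull.
have specr i : spec (S i) r = 0.
  (* Since [p] is monic, its degree survives specialization, while that of [r] can only drop: a
     divisible remainder must vanish. *)
  have size_spec : size (spec (S i) p) = size p.
    by rewrite size_map_poly_id0 // (monicP p_monic) rmorph1 oner_neq0.
  have dvdr : spec (S i) p %| spec (S i) r.
    by have := dvdS i; rewrite qE rmorphD rmorphM /= dvdp_addr // dvdp_mull.
  apply: contraTeq dvdr => r_neq0; rewrite gtNdvdp // size_spec.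
  by rewrite (leq_ltn_trans (size_poly _ _)) // Pdiv.Ring.ltn_rmodpN0 // monic_neq0.
apply/polyP=> j; rewrite coef0.
apply: (@roots_geq_poly_eq0 _ _ [seq S i | i <- iota 0 (size r`_j)]).
- apply/allP=> _ /mapP[i _ ->]; rewrite rootE.
  by have /polyP/(_ j) := specr i; rewrite coef_map coef0 => /eqP.
- by rewrite map_inj_uniq // iota_uniq.
by rewrite size_map size_iota.
Qed.

End Specialization.

(** * Corank one minors and pencils on a line *)

Lemma rank_eigenspace (k : fieldType) m (M : 'M[k]_m) a :
  \rank (eigenspace M a) = (m - \rank (a%:M - M)%R)%N.
Proof. by rewrite mxrank_ker -opprB mxrank_opp. Qed.

(** One-sided inverses of the two factors of a rank factorization serve in place of a choice of rows
    and columns with nonzero minor. *)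
Lemma exists_unit_minor (k : fieldType) m (B : 'M[k]_m) :
  exists (U : 'M_(\rank B, m)) (V : 'M_(m, \rank B)), U *m B *m V = 1%:M.
Proof.
exists (pinvmx (col_base B)), (pinvmx (row_base B)).
transitivity (pinvmx (col_base B) *m (col_base B *m row_base B) *m pinvmx (row_base B)).
  by rewrite mulmx_base.
rewrite mulmxA mulVpmx ?col_base_full // mul1mx.
by rewrite mulmxVp ?row_base_free.
Qed.

(** The factor ['X] makes [0] a root, so that the eigenvalue [0] needs no separate treatment in the
    divisibility. *)
Definition pencil_minor (R : comNzRingType) m r (U : 'M[R]_(r, m))
    (V : 'M[R]_(m, r)) (M : 'M[R]_m) : {poly R} :=
  'X * \det (map_mx polyC U *m char_poly_mx M *m map_mx polyC V).

Lemma root_pencil_minor (k : fieldType) m r (U : 'M[k]_(r, m)) V M a :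
  root (pencil_minor U V M) a = (a == 0) || (\det (U *m (a%:M - M) *m V) == 0).
Proof.
rewrite /pencil_minor rootM rootX; congr (_ || _).
rewrite rootE -horner_evalE -det_map_mx !map_mxM /=.
rewrite /char_poly_mx map_mxB map_scalar_mx /= horner_evalE hornerX.
have polyCK n1 n2 (A : 'M[k]_(n1, n2)) :
    map_mx (horner_eval a) (map_mx polyC A) = A.
  by apply/matrixP=> i j; rewrite !mxE horner_evalE hornerC.
by rewrite !polyCK.
Qed.

Lemma map_pencil_minor (R S : comNzRingType) (f : {rmorphism R -> S}) m r
    (U : 'M[R]_(r, m)) V M :
  map_poly f (pencil_minor U V M) =
  pencil_minor (map_mx f U) (map_mx f V) (map_mx f M).
Proof.
rewrite /pencil_minor rmorphM /= map_polyX -det_map_mx !map_mxM /= map_char_poly_mx.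
by congr (_ * \det (_ *m _ *m _)); apply/matrixP=> i j; rewrite !mxE map_polyC.
Qed.

Lemma simple_eigenvalue_on_line (C : closedFieldType) m (M0 M1 : 'M[C]_m)
    (S : nat -> C) z :
  injective S -> has_simple_nonzero_eigenvalue (M0 + z *: M1) ->
  exists i, has_simple_nonzero_eigenvalue (M0 + S i *: M1).
Proof.
move=> S_inj [a [a_neq0 a_eig rank_a]].
apply: boolp.contrapT => no_simple.
set B := a%:M - (M0 + z *: M1).
have rankB : \rank B = m.-1.
  have := rank_eigenspace (M0 + z *: M1) a; rewrite rank_a -/B => mE.
  have lt_m : (0 < m - \rank B)%N by rewrite -mE.
  by rewrite -subn1 mE subKn // rank_leq_row.
have [U [V UBV]] := exists_unit_minor B.
pose M : 'M[{poly C}]_m := map_mx polyC M0 + 'X *: map_mx polyC M1.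
have specM x : map_mx (horner_eval x) M = M0 + x *: M1.
  by apply/matrixP=> i j; rewrite !mxE horner_evalE !hornerE.
have specC n1 n2 x (N : 'M[C]_(n1, n2)) :
    map_mx (horner_eval x) (map_mx polyC N) = N.
  by apply/matrixP=> i j; rewrite !mxE horner_evalE hornerC.
pose Q : {poly {poly C}} := pencil_minor (map_mx polyC U) (map_mx polyC V) M.
(* The exponent [m] is the degree of the characteristic polynomial; it is the same at every point
   [S i], as the extension to [z] requires. *)
have dvdM : map_poly (horner_eval z) (char_poly M) %|
            map_poly (horner_eval z) (Q ^+ m).
  apply: (dvdp_spec (char_poly_monic M) S_inj) => i.
  rewrite rmorphXn /= map_pencil_minor map_char_poly specM !specC.
  apply: dvdp_expn_of_roots; rewrite ?char_poly_monic ?size_char_poly // => b.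
  rewrite -eigenvalue_root_char root_pencil_minor => b_eig.
  have [//|b_neq0 /=] := eqVneq b 0.
  apply: contraPT no_simple => det_neq0 []; exists i, b; split=> //.
  (* A nonzero minor at [b] bounds the rank below by [m.-1], so the eigenspace of [b] is a line and
     [b] is simple. *)
  have := b_eig; rewrite /eigenvalue -mxrank_eq0 -lt0n => rank_gt0.
  apply/eqP; rewrite eqn_leq rank_gt0 andbT rank_eigenspace leq_subLR addn1.
  apply: (@leq_trans (\rank B).+1); first by rewrite rankB leqSpred.
  rewrite ltnS; have := det_neq0; rewrite -unitfE -unitmxE => /mxrank_unit <-.
  by rewrite (leq_trans (mxrankM_maxl _ _)) // mxrankM_maxr.
have : root (pencil_minor U V (M0 + z *: M1) ^+ m) a.
  move: dvdM; rewrite rmorphXn /= map_pencil_minor map_char_poly specM !specC.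
  by move/root_dvdp; apply; rewrite -eigenvalue_root_char.
(* At [a] the compressed matrix is [U *m B *m V = 1], so the minor is nonzero there. *)
rewrite /root hornerE expf_eq0 => /andP[_].
by rewrite -[_ == 0]/(root _ _) root_pencil_minor -/B UBV det1 (negPf a_neq0) oner_eq0.
Qed.

Theorem theorem4 :
  (forall (k : fieldType) (d g : nat) (A : 'I_g -> 'M[k]_d),
      [pchar k] =i pred0 ->
      (0 < d)%N ->
      generates_mx A ->
      exists (n : nat) (X : 'I_g -> 'M[k]_n),
        has_simple_nonzero_eigenvalue (\sum_(i < g) X i *t A i))
  /\
  (forall (R : realType) (d g : nat) (A : 'I_g -> 'M[R[i]]_d),
      (0 < d)%N ->
      generates_mx A ->
      (forall i, A i \is hermsymmx) ->
      exists (n : nat) (X : 'I_g -> 'M[R[i]]_n),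
        (forall i, X i \is hermsymmx) /\
        has_simple_nonzero_eigenvalue (\sum_(i < g) X i *t A i)).
Proof.
split=> [k d g A _|R d g A]; first exact: exists_simple_eigenvalue.
move=> d_gt0 genA _; have [n [X simpleX]] := exists_simple_eigenvalue d_gt0 genA.
(* Hermitian parts of [X i]; the second uses that the inverse of [2 * 'i] is [- 'i / 2]. *)
pose H i := 2^-1 *: (X i + map_mx Num.conj (X i)^T).
pose K i := (2^-1 * 'i) *: (map_mx Num.conj (X i)^T - X i).
have XE : \sum_i X i *t A i = \sum_i H i *t A i + 'i *: \sum_i K i *t A i.
  rewrite scaler_sumr -big_split; apply: eq_bigr => i _; apply/matrixP=> p q.
  rewrite !mxE mulrA -mulrDl; congr (_ * _).
  rewrite mulrA (mulrC 'i) -(mulrA 2^-1) -expr2 sqrCi mulrN1 mulNr -mulrBr opprB.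
  rewrite addrACA subrr addr0 -mulr2n.
  by rewrite -[X in _ * X]mulr_natl mulKf ?pnatr_eq0.
(* Natural numbers give infinitely many parameters and are real, which keeps [H i + j%:R *: K i]
   hermitian. *)
have natr_inj : injective (fun j => j%:R : R[i]).
  by move=> j l /eqP; rewrite eqr_nat => /eqP.
rewrite XE in simpleX; have [j] := simple_eigenvalue_on_line natr_inj simpleX.
have -> : \sum_i H i *t A i + j%:R *: \sum_i K i *t A i =
    \sum_i (H i + j%:R *: K i) *t A i.
  rewrite scaler_sumr -big_split; apply: eq_bigr => i _; apply/matrixP=> p q.
  by rewrite !mxE mulrA mulrDl.
move=> simple_j; exists n, (fun i => H i + j%:R *: K i); split=> // i.
apply/is_hermitianmxP; rewrite expr0 scale1r; apply/matrixP=> p q.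
rewrite !mxE rmorphD !rmorphM rmorphD rmorphB /= conjCi fmorphV !rmorph_nat !conjCK.
congr (_ * _ + _ * _); first by rewrite addrC.
by rewrite mulrN mulNr -mulrN opprB.
Qed.
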